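(* $\bigl(\widehat{\mathcal C}(\mathbb R^n),\widehat h\bigr)$ is a complete metric space.
   Context: $\mathbb R^n$ carries the Euclidean distance $d$. For nonempty $A,B\subseteq\mathbb R^n$, with $d(x,A)=d(A,x)=\inf\{d(x,a):a\in A\}$, the Hausdorff distance is $h(A,B)=\max\{\sup_{a\in A}d(a,B),\ \sup_{b\in B}d(A,b)\}$, and $\widetilde h(A,B)=\inf\{h(\varphi(A),\psi(B)):\varphi,\psi\text{ isometries of }\mathbb R^n\}$. A similitude is a map $S:\mathbb R^n\to\mathbb R^n$ such that for some $r>0$, $d(S(x),S(y))=r\,d(x,y)$ for all $x,y$. Nonempty sets $A,B$ are similar if $B=S(A)$ for some similitude $S$; this is an equivalence relation and the class of $A$ is $\widehat A$. The radius of $A$ is $\mathrm r(A)=\inf_{x\in\mathbb R^n}\sup_{a\in A}d(x,a)$. For $\rho\ge0$, $\rho A=\{\rho a:a\in A\}$, and $\frac{A}{\mathrm r(A)}=\frac1{\mathrm r(A)}A$, with the convention that $\frac{A}{\mathrm r(A)}$ means $A$ when $A$ is a singleton. For nonempty bounded $A,B$ the relative shape difference is $\widehat h(A,B)=\widetilde h\bigl(\frac A{\mathrm r(A)},\frac B{\mathrm r(B)}\bigr)$; it depends only on the similarity classes and one sets $\widehat h(\widehat A,\widehat B):=\widehat h(A,B)$. $\mathcal C(\mathbb R^n)$ is the set of nonempty compact subsets of $\mathbb R^n$, and $\widehat{\mathcal C}(\mathbb R^n)=\{\widehat C: C\in\mathcal C(\mathbb R^n)\}$. *)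

(* Defs.v *)
From HB Require Import structures.
From mathcomp Require Import all_boot all_order all_algebra.
From mathcomp Require Import all_classical all_reals all_analysis.
From mathcomp Require Import ring lra.

Set Implicit Arguments.
Unset Strict Implicit.
Unset Printing Implicit Defensive.

Import Order.TTheory GRing.Theory Num.Theory.
Import numFieldNormedType.Exports.

Local Open Scope classical_set_scope.
Local Open Scope ring_scope.

Section Euclidean.
Context {R : realType} {n : nat}.
Implicit Types (A B C : set 'rV[R]_n) (x y : 'rV[R]_n).

(* The library norm on 'rV[R]_n is the sup norm, hence this separate distance;
   the topology (so [compact]) is the same for both. *)
Definition dist x y : R := Num.sqrt (\sum_(i < n) (x 0 i - y 0 i) ^+ 2).

Definition isometry (phi : 'rV[R]_n -> 'rV[R]_n) : Prop :=
  forall x y, dist (phi x) (phi y) = dist x y.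

Definition similitude (S : 'rV[R]_n -> 'rV[R]_n) : Prop :=
  exists2 r : R, 0 < r & forall x y, dist (S x) (S y) = r * dist x y.

Definition similar A B : Prop :=
  exists2 S, similitude S & B = S @` A.

(* Infima and suprema are taken in \bar R: no junk value appears when a set is
   empty or unbounded. *)
Definition dist_set x A : \bar R := ereal_inf [set (dist x a)%:E | a in A].

Definition hausdorff A B : \bar R :=
  maxe (ereal_sup [set dist_set a B | a in A])
       (ereal_sup [set dist_set b A | b in B]).

Definition hausdorff_isom A B : \bar R :=
  ereal_inf [set h | exists phi psi, [/\ isometry phi, isometry psi &
                     h = hausdorff (phi @` A) (psi @` B)]].

Definition radius A : \bar R :=
  ereal_inf (range (fun x => ereal_sup [set (dist x a)%:E | a in A])).

Definition scale (rho : R) A : set 'rV[R]_n := [set rho *: a | a in A].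

Definition is_singleton A : Prop := exists a, A = [set a].

Definition normalize A : set 'rV[R]_n :=
  if `[< is_singleton A >] then A else scale (fine (radius A))^-1 A.

(* Meant for nonempty bounded sets, see [hausdorff_isom_normalize_fin_num]. *)
Definition shape_diff A B : R :=
  fine (hausdorff_isom (normalize A) (normalize B)).

Definition sim_class A : set (set 'rV[R]_n) := [set B | similar A B].

End Euclidean.

Section ShapeSpace.
Variables (R : realType) (n : nat).

Definition compacts : set (set 'rV[R]_n) := [set A | compact A /\ A !=set0].

Definition shapes : set (set (set 'rV[R]_n)) := sim_class @` compacts.

Definition shape_repr (K : shapes) : set 'rV[R]_n :=
  s2val (cid2 (set_mem (valP K))).

(* Independent of the representatives, see [class_diffE]. *)
Definition class_diff (K L : shapes) : R :=
  shape_diff (shape_repr K) (shape_repr L).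

End ShapeSpace.
Arguments compacts : clear implicits.
Arguments shapes : clear implicits.
Arguments class_diff {R n}.

Section Metric.
Context {R : realType} {T : Type}.
Implicit Type d : T -> T -> R.

Definition is_metric d : Prop :=
  [/\ forall x y, 0 <= d x y,
      forall x y, d x y = 0 <-> x = y,
      forall x y, d x y = d y x &
      forall x y z, d x z <= d x y + d y z].

Definition is_cauchy d (u : nat -> T) : Prop :=
  forall e, 0 < e -> exists N : nat,
    forall i j, (N <= i)%N -> (N <= j)%N -> d (u i) (u j) < e.

Definition converges_to d (u : nat -> T) (l : T) : Prop :=
  forall e, 0 < e -> exists N : nat, forall i, (N <= i)%N -> d (u i) l < e.

Definition is_complete d : Prop :=
  forall u, is_cauchy d u -> exists l, converges_to d u l.

End Metric.

Section WellDefined.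
Context {R : realType} {n : nat}.
Implicit Types (A B C : set 'rV[R]_n) (x y : 'rV[R]_n).

Let dot x y : R := \sum_(i < n) x 0 i * y 0 i.

Let dot_mx x y : dot x y = (x *m y^T) 0 0.
Proof. by rewrite mxE; apply: eq_bigr => i _; rewrite mxE. Qed.

Let dotDl x y z : dot (x + y) z = dot x z + dot y z.
Proof. by rewrite !dot_mx mulmxDl mxE. Qed.

Let dotZl (a : R) x z : dot (a *: x) z = a * dot x z.
Proof. by rewrite !dot_mx -scalemxAl mxE. Qed.

Let dotC x y : dot x y = dot y x.
Proof. by apply: eq_bigr => i _; rewrite mulrC. Qed.

Let dot_ge0 x : 0 <= dot x x.
Proof. by apply: sumr_ge0 => i _; rewrite -expr2 sqr_ge0. Qed.

Let dot_eq0 x : dot x x = 0 -> x = 0.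
Proof.
move=> /eqP; rewrite psumr_eq0; last by move=> i _; rewrite -expr2 sqr_ge0.
move=> /allP x0; apply/rowP => i; rewrite mxE; apply/eqP.
by have := x0 i (mem_index_enum i); rewrite /= -expr2 sqrf_eq0.
Qed.

Let dotBB x y : dot (x - y) (x - y) = dot x x - 2 * dot x y + dot y y.
Proof.
rewrite -scaleN1r dotDl dotZl ![dot _ (x + _)]dotC !dotDl !dotZl (dotC y x).
by ring.
Qed.

Let distE x y : dist x y = Num.sqrt (dot (x - y) (x - y)).
Proof. by congr Num.sqrt; apply: eq_bigr => i _; rewrite !mxE expr2. Qed.

Let dist2 x y : dist x y ^+ 2 = dot (x - y) (x - y).
Proof. by rewrite distE sqr_sqrtr. Qed.

Let distC x y : dist x y = dist y x.
Proof.
by congr Num.sqrt; apply: eq_bigr => i _; rewrite -opprB sqrrN.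
Qed.

Let dist_ge0 x y : 0 <= dist x y.
Proof. exact: sqrtr_ge0. Qed.

Let distZ (r : R) x y : 0 <= r -> dist (r *: x) (r *: y) = r * dist x y.
Proof.
move=> r0; apply/eqP; rewrite -(@eqrXn2 _ 2)// ?mulr_ge0//.
by rewrite exprMn !dist2 -scalerBr dotZl dotC dotZl mulrA expr2.
Qed.

Lemma isometry_orthogonal (f : 'rV[R]_n -> 'rV[R]_n) : isometry f ->
  exists2 M : 'M[R]_n, M *m M^T = 1%:M & forall x, f x = x *m M + f 0.
Proof.
move=> isof; have [g gE] : exists g, forall x, g x = f x - f 0.
  by exists (fun x => f x - f 0).
have gd x y : dot (g x - g y) (g x - g y) = dot (x - y) (x - y).
  by rewrite -(dist2 x y) -isof dist2 !gE opprD opprK addrACA addNr addr0.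
have g0 : g 0 = 0 by rewrite gE subrr.
have gg x : dot (g x) (g x) = dot x x by have := gd x 0; rewrite g0 !subr0.
have gxy x y : dot (g x) (g y) = dot x y.
  by have := gd x y; rewrite !dotBB !gg; lra.
pose M : 'M[R]_n := \matrix_i g (delta_mx 0 i).
have rowM i : row i M = g (delta_mx 0 i) by rewrite rowK.
have MM : M *m M^T = 1%:M.
  apply/matrixP => i j.
  have -> : (M *m M^T) i j = dot (row i M) (row j M).
    by rewrite mxE; apply: eq_bigr => k _; rewrite !mxE.
  rewrite !rowM gxy dot_mx trmx_delta mul_delta_mx_cond !mxE.
  by case: eqVneq => _; rewrite ?mulr1n ?mulr0n !mxE.
have dotM x y : dot (x *m M) (y *m M) = dot x y.
  by rewrite !dot_mx trmx_mul mulmxA -(mulmxA x) MM mulmx1.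
have gM x : g x = x *m M.
  have dgM : dot (g x) (x *m M) = dot x x.
    rewrite mulmx_sum_row dot_mx linear_sum mulmx_sumr summxE.
    apply: eq_bigr => i _; rewrite linearZ -scalemxAr mxE rowM -dot_mx gxy.
    by rewrite dot_mx trmx_delta -colE mxE.
  apply/eqP; rewrite -subr_eq0; apply/eqP/dot_eq0.
  by rewrite dotBB dgM gg dotM; ring.
by exists M => // x; rewrite -gM gE subrK.
Qed.

Let sim_inv (S : 'rV[R]_n -> 'rV[R]_n) (r : R) :
  0 < r -> (forall x y, dist (S x) (S y) = r * dist x y) ->
  exists S' : 'rV[R]_n -> 'rV[R]_n,
    [/\ cancel S S', cancel S' S &
        forall x y, dist (S' x) (S' y) = r^-1 * dist x y].
Proof.
move=> r0 Sr; have rn0 : r != 0 by rewrite gt_eqF.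
have [M MM SE] : exists2 M : 'M[R]_n, M *m M^T = 1%:M &
    forall x, r^-1 *: S x = x *m M + r^-1 *: S 0.
  apply: (@isometry_orthogonal (fun x => r^-1 *: S x)) => x y.
  by rewrite distZ ?invr_ge0 ?ltW// Sr mulKf.
have MM' : M^T *m M = 1%:M by exact: mulmx1C.
pose S' y := (r^-1 *: y - r^-1 *: S 0) *m M^T.
have SS' : cancel S S'.
  by move=> x; rewrite /S' SE addrK -mulmxA MM mulmx1.
have S'S : cancel S' S.
  move=> y; apply: (scalerI (a := r^-1)); first by rewrite invr_eq0.
  by rewrite SE /S' -mulmxA MM' mulmx1 subrK.
exists S'; split => // x y.
by rewrite -{2}(S'S x) -{2}(S'S y) Sr mulKf.
Qed.

Lemma isometry_inv (f : 'rV[R]_n -> 'rV[R]_n) : isometry f ->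
  exists g, [/\ isometry g, cancel f g & cancel g f].
Proof.
move=> isof.
have [x y|g [fg gf gd]] := @sim_inv f 1 ltr01; first by rewrite mul1r isof.
by exists g; split => // x y; rewrite gd invr1 mul1r.
Qed.

Lemma similar_refl A : similar A A.
Proof.
exists id; last by rewrite image_id.
by exists 1 => // x y; rewrite mul1r.
Qed.

Lemma similar_sym A B : similar A B -> similar B A.
Proof.
move=> [S [r r0 Sr] ->]; have [S' [SS' _ S'r]] := sim_inv r0 Sr.
exists S'; first by exists r^-1; rewrite ?invr_gt0.
rewrite image_comp; apply/seteqP; split => [a Aa|_ [a Aa <-]] /=.
  by exists a => //=; rewrite SS'.
by rewrite SS'.
Qed.

Lemma similar_trans A B C : similar A B -> similar B C -> similar A C.
Proof.
move=> [S [r r0 Sr] ->] [S' [r' r'0 S'r] ->].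
exists (S' \o S); last by rewrite image_comp.
by exists (r' * r); [rewrite mulr_gt0|move=> x y /=; rewrite S'r Sr mulrA].
Qed.

Lemma sim_class_eqP A B : sim_class A = sim_class B <-> similar A B.
Proof.
split=> [AB|AB].
  by have := similar_refl B; rewrite -[similar B B]/(sim_class B B) -AB.
apply/seteqP; split => C; first exact/similar_trans/similar_sym.
exact: similar_trans.
Qed.

Lemma radius_similitude (S : 'rV[R]_n -> 'rV[R]_n) (r : R) A :
  0 < r -> (forall x y, dist (S x) (S y) = r * dist x y) ->
  radius (S @` A) = (r%:E * radius A)%E.
Proof.
move=> r0 Sr; have [S' [SS' S'S _]] := sim_inv r0 Sr.
have supE x : (ereal_sup [set (dist (S x) a)%:E | a in S @` A] =
    r%:E * ereal_sup [set (dist x a)%:E | a in A])%E.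
  rewrite -ereal_sup_pZl// !image_comp; congr ereal_sup.
  by apply: eq_imagel => a _ /=; rewrite Sr EFinM.
rewrite /radius -ereal_inf_pZl// image_comp; congr ereal_inf.
apply/seteqP; split => [_ [x _ <-]|_ [x _ <-]] /=.
  by exists (S' x) => //=; rewrite -supE S'S.
by exists (S x) => //=; rewrite supE.
Qed.

Lemma normalize_similar A B : A !=set0 -> similar A B ->
  exists2 sigma, isometry sigma & normalize B = sigma @` normalize A.
Proof.
move=> A0 [S [r r0 Sr] ->]; have [S' [SS' S'S S'r]] := sim_inv r0 Sr.
have sgE : is_singleton (S @` A) <-> is_singleton A.
  split=> [[b Sb]|[a ->]]; last by exists (S a); rewrite image_set1.
  exists (S' b); have /seteqP[sub _] := Sb.
  have AS' a : A a -> a = S' b by move=> Aa; rewrite -(sub (S a))//; exists a.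
  apply/seteqP; split => [a /AS'//|_ ->]; case: A0 => a Aa.
  by rewrite -(AS' a).
rewrite /normalize; case: asboolP => /sgE; case: asboolP => // sA _.
  case: sA => a ->; exists (fun x => x + (S a - a)).
    by move=> x y; rewrite !distE opprD addrACA subrr addr0.
  by rewrite !image_set1 addrC subrK.
rewrite (radius_similitude _ r0 Sr).
have -> : fine (r%:E * radius A)%E = r * fine (radius A).
  case: (radius A) => [s| |]//=.
    by rewrite gt0_muley ?lte_fin//= mulr0.
  by rewrite gt0_muleNy ?lte_fin//= mulr0.
set rho := fine _; have [->|rho0] := eqVneq rho 0.
  exists id; first by [].
  rewrite mulr0 invr0 image_id /scale image_comp.
  by apply: eq_imagel => a _ /=; rewrite !scale0r.
have {}rho0 : 0 < rho.
  rewrite lt0r rho0 fine_ge0//; apply: le_ereal_inf_tmp => _ [x _ <-].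
  by case: A0 => a Aa; apply: le_ereal_sup_tmp; exists (dist x a)%:E => //=;
    [exists a | rewrite lee_fin].
exists (fun x => (r * rho)^-1 *: S (rho *: x)).
  move=> x y; rewrite distZ ?invr_ge0 ?mulr_ge0 ?ltW// Sr distZ ?ltW//.
  by rewrite (mulrA r) mulKf// gt_eqF// mulr_gt0.
rewrite /scale !image_comp; apply: eq_imagel => a _ /=.
by rewrite scalerA divff ?scale1r// gt_eqF.
Qed.

Lemma hausdorff_isom_image (sigma tau : 'rV[R]_n -> 'rV[R]_n) A B :
  isometry sigma -> isometry tau ->
  hausdorff_isom (sigma @` A) (tau @` B) = hausdorff_isom A B.
Proof.
move=> /[dup] isos /isometry_inv[s' [isos' ss' _]].
move=> /[dup] isot /isometry_inv[t' [isot' tt' _]].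
congr ereal_inf; apply/seteqP; split => h /= [phi [psi [isop isoq ->]]].
  exists (phi \o sigma), (psi \o tau); split.
  - by move=> x y /=; rewrite isop isos.
  - by move=> x y /=; rewrite isoq isot.
  - by rewrite !image_comp.
exists (phi \o s'), (psi \o t'); split.
- by move=> x y /=; rewrite isop isos'.
- by move=> x y /=; rewrite isoq isot'.
- by rewrite !image_comp; congr hausdorff; apply: eq_imagel => a _ /=;
    rewrite ?ss' ?tt'.
Qed.

Lemma shape_diff_similar A A' B B' : A !=set0 -> B !=set0 ->
  similar A A' -> similar B B' -> shape_diff A' B' = shape_diff A B.
Proof.
move=> A0 B0 /(normalize_similar A0)[s isos sE] /(normalize_similar B0)[t isot tE].
by rewrite /shape_diff sE tE hausdorff_isom_image.
Qed.

Lemma hausdorff_isom_normalize_fin_num A B :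
  A !=set0 -> B !=set0 -> bounded_set A -> bounded_set B ->
  hausdorff_isom (normalize A) (normalize B) \is a fin_num.
Proof.
have coord x i : `|x 0 i| <= `|x|.
  rewrite [leRHS]/Num.norm /= mx_normrE; apply/bigmax_geP; right => /=.
  by exists (0, i).
have bndN C : bounded_set C -> exists M : R,
    forall c, normalize C c -> forall i, `|c 0 i| <= M.
  move=> [M [_ /(_ (M + 1))]]; rewrite ltrDl ltr01 => /(_ isT) CM.
  rewrite /normalize; case: asboolP => _.
    by exists (M + 1) => c /CM cM i; exact: le_trans (coord _ _) cM.
  exists (`|(fine (radius C))^-1| * (M + 1)) => _ [c /CM cM <-] i.
  by rewrite mxE normrM ler_wpM2l//; exact: le_trans (coord _ _) cM.
have neN C : C !=set0 -> normalize C !=set0.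
  move=> [c Cc]; rewrite /normalize; case: asboolP => _; first by exists c.
  by eexists; exists c.
move=> /neN[a Aa] /neN[b Bb] /bndN[MA hA] /bndN[MB hB].
rewrite ge0_fin_numE; last first.
  apply: le_ereal_inf_tmp => _ [phi [psi [_ _ ->]]]; rewrite le_max.
  apply/orP; left; apply: le_ereal_sup_tmp.
  exists (dist_set (phi a) (psi @` normalize B)).
    by exists (phi a) => //; exists a.
  by apply: le_ereal_inf_tmp => _ [y _ <-]; rewrite lee_fin.
pose K : R := Num.sqrt (\sum_(i < n) (MA + MB) ^+ 2).
have dK x y : normalize A x -> normalize B y -> dist x y <= K.
  move=> Ax By; rewrite ler_wsqrtr//; apply: ler_sum => i _.
  rewrite -real_normK ?num_real// lerXn2r ?nnegrE//.
    by rewrite addr_ge0// (le_trans _ (hA _ Ax i), le_trans _ (hB _ By i)).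
  by rewrite (le_trans (ler_normB _ _))// lerD// ?hA ?hB.
apply: (@le_lt_trans _ _ K%:E); last exact: ltry.
apply: ge_ereal_inf; exists (hausdorff (normalize A) (normalize B)).
  by exists id, id; split => //; rewrite !image_id.
rewrite ge_max; apply/andP; split; apply: ge_ereal_sup => _ [c Cc <-].
  by apply: ge_ereal_inf; exists (dist c b)%:E; [exists b|rewrite lee_fin dK].
by apply: ge_ereal_inf; exists (dist c a)%:E;
  [exists a|rewrite lee_fin distC dK].
Qed.

Lemma class_diffE (K L : shapes R n) A B :
  compacts R n A -> compacts R n B -> val K = sim_class A -> val L = sim_class B ->
  class_diff K L = shape_diff A B.
Proof.
move=> [_ A0] [_ B0] KA LB; apply: shape_diff_similar => //;
  apply/sim_class_eqP; rewrite -?KA -?LB /shape_repr; by case: cid2.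
Qed.

End WellDefined.

(* Main.v *)
Require Import Defs.
From mathcomp Require Import all_boot all_order all_algebra.
From mathcomp Require Import all_classical all_reals all_analysis.
From mathcomp Require Import ring lra.
Import Defs.

(**
The infimum defining [shape_diff A B] is compared with real numbers only through
the relation [congruent_within e] between normalized sets, which says that some
isometric copy of one set is within Hausdorff distance [e] of the other.
Both sides may be moved in the definition of the distance up to isometry, but
isometries are invertible, so moving one of them is enough. The
triangle inequality and the symmetry are then compositions and inverses of
isometries.

Separation is where compactness enters. If [A] is congruent to [B] within every
[e > 0], the isometries realizing smaller and smaller [e] send a point of [B]
close to the bounded set [A], so that they are bounded at each point; by
Tychonoff's theorem they have a pointwise cluster point
([pointwise_cluster]). It is again an isometry, and pointwise information
already suffices to see that it maps [B] onto [A] ([congruent_within_all]).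
Normalization is a similitude of each compact set, so vanishing of the
difference is similarity.

For completeness, a Cauchy sequence of shapes has a subsequence whose
consecutive terms are at distance less than [2^-k]. Composing the isometries
that nearly realize these distances aligns the normalized representatives into
one sequence of compact sets that is Cauchy for the Hausdorff distance itself
([align_chain]), and this sequence has a compact limit [C]
([hausdorff_complete]). It remains to see that normalizing [C] does not change
it. A normalized set has radius 0 (a singleton) or 1, and the radius is
1-Lipschitz for the Hausdorff distance, so the radius of [C] is 0 or 1 too
([radius_limit_normalized]); this also keeps singletons apart from all other
shapes.
*)

Set Implicit Arguments.
Unset Strict Implicit.
Unset Printing Implicit Defensive.

Import Order.TTheory GRing.Theory Num.Theory.
Import numFieldNormedType.Exports.

Local Open Scope classical_set_scope.
Local Open Scope ring_scope.

(** * The Euclidean distance and compactness in terms of it *)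

Section EuclideanDistance.
Context {R : realType} {n : nat}.
Implicit Types (A B C : set 'rV[R]_n) (x y z : 'rV[R]_n) (e r : R).

Lemma dist_ge0 x y : 0 <= dist x y.
Proof. exact: sqrtr_ge0. Qed.

Lemma sqr_dist x y : dist x y ^+ 2 = \sum_i (x 0 i - y 0 i) ^+ 2.
Proof. by rewrite sqr_sqrtr// sumr_ge0// => i _; rewrite sqr_ge0. Qed.

Lemma distxx x : dist x x = 0.
Proof.
by rewrite /dist big1 ?sqrtr0// => i _; rewrite subrr expr0n.
Qed.

Lemma distC x y : dist x y = dist y x.
Proof. by congr Num.sqrt; apply: eq_bigr => i _; rewrite -opprB sqrrN. Qed.

Lemma coord_le_dist x y i : `|x 0 i - y 0 i| <= dist x y.
Proof.
rewrite -sqrtr_sqr ler_wsqrtr// (bigD1 i)//= lerDl sumr_ge0// => j _.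
exact: sqr_ge0.
Qed.

(** With [dist_le_norm], this lets the Euclidean distance replace the sup norm
in every topological notion below. *)
Lemma norm_le_dist x y : `|x - y| <= dist x y.
Proof.
rewrite [leLHS]/Num.norm /= mx_normrE; apply/bigmax_leP; split.
  exact: dist_ge0.
by move=> [i j] _ /=; rewrite !mxE ord1 coord_le_dist.
Qed.

Lemma dist_le_norm x y : dist x y <= Num.sqrt n%:R * `|x - y|.
Proof.
rewrite -[X in _ * X](ger0_norm (normr_ge0 _)) -sqrtr_sqr -sqrtrM// ler_wsqrtr//.
rewrite -[n in n%:R]card_ord -sum1_card natr_sum mulr_suml.
apply: ler_sum => i _; rewrite mul1r -real_normK ?num_real// lerXn2r ?nnegrE//.
rewrite [leRHS]/Num.norm /= mx_normrE; apply/bigmax_geP; right => /=.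
by exists (0, i) => //=; rewrite !mxE.
Qed.

Lemma dist_eq0 x y : dist x y = 0 -> x = y.
Proof.
move=> d0; apply/eqP; rewrite -subr_eq0 -normr_le0 -d0; exact: norm_le_dist.
Qed.

(** For positive [a = dist x y] and [b = dist y z], Cauchy-Schwarz is the
nonnegativity of the square sum of [b (x - y) - a (y - z)], which expands
to [a b ((a + b)^2 - (dist x z)^2)]. *)
Lemma dist_triangle y x z : dist x z <= dist x y + dist y z.
Proof.
have [/dist_eq0 ->|a0] := eqVneq (dist x y) 0; first by rewrite distxx add0r.
have [/dist_eq0 ->|b0] := eqVneq (dist y z) 0; first by rewrite distxx addr0.
have {a0}a0 : 0 < dist x y by rewrite lt0r a0 dist_ge0.
have {b0}b0 : 0 < dist y z by rewrite lt0r b0 dist_ge0.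
rewrite -(@ler_pXn2r _ 2)// ?nnegrE ?addr_ge0 ?dist_ge0//.
have := sqr_dist x y; have := sqr_dist y z; have := sqr_dist x z.
set a := dist x y in a0 *; set b := dist y z in b0 *; set c := dist x z.
move=> cE bE aE.
have : 0 <= \sum_i (b * (x 0 i - y 0 i) - a * (y 0 i - z 0 i)) ^+ 2.
  by apply: sumr_ge0 => i _; exact: sqr_ge0.
have -> : \sum_i (b * (x 0 i - y 0 i) - a * (y 0 i - z 0 i)) ^+ 2 =
    (b * (b + a)) * a ^+ 2 + (a * (a + b)) * b ^+ 2 - (a * b) * c ^+ 2.
  rewrite aE bE cE !mulr_sumr -big_split/= -sumrN -big_split/=.
  by apply: eq_bigr => i _; ring.
have -> : b * (b + a) * a ^+ 2 + a * (a + b) * b ^+ 2 - a * b * c ^+ 2 =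
   (a * b) * ((a + b) ^+ 2 - c ^+ 2) by ring.
by rewrite pmulr_rge0 ?mulr_gt0// subr_ge0.
Qed.

Lemma nbhs_dist x e : 0 < e -> nbhs x [set y | dist x y < e].
Proof.
move=> e0; have s0 : 0 < Num.sqrt n%:R + 1 :> R.
  by rewrite ltr_wpDl// sqrtr_ge0.
apply/nbhs_ballP; exists (e / (Num.sqrt n%:R + 1)) => /=; first exact: divr_gt0.
move=> y; rewrite -ball_normE /= ltr_pdivlMr// => xy.
apply: le_lt_trans (dist_le_norm _ _) (le_lt_trans _ xy).
by rewrite mulrC ler_wpM2l// lerDl.
Qed.

Lemma closed_dist A x : closed A ->
  (forall e, 0 < e -> exists2 a, A a & dist x a < e) -> A x.
Proof.
move=> /closure_id clA xA; rewrite clA => V /nbhs_ballP[e /= e0 eV].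
have [a Aa xa] := xA e e0; exists a; split => //; apply: eV.
by rewrite -ball_normE /=; apply: le_lt_trans xa; exact: norm_le_dist.
Qed.

Lemma bounded_distP A : bounded_set A <-> exists M, forall a, A a -> dist 0 a <= M.
Proof.
split=> [[M [_ /(_ (M + 1))]]|[M AM]].
  rewrite ltrDl ltr01 => /(_ isT) AM; exists (Num.sqrt n%:R * (M + 1)) => a /AM aM.
  apply: le_trans (dist_le_norm _ _) _.
  by rewrite ler_wpM2l ?sqrtr_ge0// sub0r normrN.
exists M; split; first exact: num_real.
move=> r Mr a /AM aM; have := norm_le_dist 0 a; rewrite sub0r normrN => na.
by apply: le_trans na (le_trans aM _); exact: ltW.
Qed.

(** Heine-Borel, phrased with the distance so that later arguments need no
filters. *)
Lemma compact_distP A : compact A <->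
  (exists M, forall a, A a -> dist 0 a <= M) /\
  (forall x, (forall e, 0 < e -> exists2 a, A a & dist x a < e) -> A x).
Proof.
split=> [cA|[/bounded_distP bA clA]].
  split; first exact/bounded_distP/compact_bounded.
  by move=> x; apply: closed_dist; exact: compact_closed.
apply: bounded_closed_compact => // x Ax; apply: clA => e e0.
by have [a [Aa xa]] := Ax _ (nbhs_dist x e0); exists a.
Qed.

(** The maps [f k] stay in a product of closed balls, which is compact by
Tychonoff's theorem; a basic neighbourhood of a cluster point [g] constrains
finitely many indices, hence the sequence [s]. With [I] the space itself this
yields limits of isometries, with [I] the unit type limits of points. *)
Lemma pointwise_cluster (I : eqType) (f : nat -> I -> 'rV[R]_n) (M : I -> R) :
  (forall k i, dist 0 (f k i) <= M i) ->
  exists g : I -> 'rV[R]_n, forall (s : seq I) e N, 0 < e ->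
    exists2 k, (N <= k)%N & forall i, i \in s -> dist (f k i) (g i) < e.
Proof.
move=> fM.
have cI i : compact [set x : 'rV[R]_n | dist 0 x <= M i].
  apply/compact_distP; split; first by exists (M i).
  move=> x xM; apply/ler_addgt0Pr => e e0 /=; have [a /= aM xa] := xM e e0.
  apply: le_trans (dist_triangle a _ _) _.
  by rewrite distC in xa; apply: lerD => //; exact: ltW.
have cE := tychonoff cI.
pose F : set_system (prod_topology (fun _ : I => 'rV[R]_n)) := f @ \oo.
have FP : ProperFilter F by exact: fmap_proper_filter.
have [|g [_ Fg]] := cE F FP; first by exists 0 => // k _ i; exact: fM.
exists g => s e N e0.
have gs : nbhs g [set h : prod_topology (fun _ : I => 'rV[R]_n) |
    forall i, i \in s -> dist (h i) (g i) < e].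
  elim: s => [|i s IHs]; first exact: filterE.
  have gi : nbhs g (proj i @^-1` [set y | dist (g i) y < e]).
    by apply: proj_continuous; exact: nbhs_dist.
  apply: filterS2 gi IHs => h hi hs j; rewrite inE => /predU1P[->|/hs//].
  by rewrite distC.
have FN : F (f @` [set k | (N <= k)%N]).
  by exists N => // k Nk; exists k.
have [_ [[k Nk <-] ks]] := Fg _ _ FN gs.
by exists k.
Qed.

End EuclideanDistance.
(** * Hausdorff distance of compact sets *)

Section HausdorffDistance.
Context {R : realType} {n : nat}.
Implicit Types (A B C : set 'rV[R]_n) (x y z : 'rV[R]_n) (e r : R).
Implicit Types phi psi : 'rV[R]_n -> 'rV[R]_n.

(** Lies between [hausdorff A B < e] and [hausdorff A B <= e]; unlike the
former, it needs no attained or nonempty supremum. *)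
Definition close e A B : Prop :=
  (forall a, A a -> exists2 b, B b & dist a b < e) /\
  (forall b, B b -> exists2 a, A a & dist b a < e).

Lemma close_refl e A : 0 < e -> close e A A.
Proof. by move=> e0; split=> a Aa; exists a; rewrite ?distxx. Qed.

Lemma close_sym e A B : close e A B -> close e B A.
Proof. by case. Qed.

Lemma close_trans B e r A C : close e A B -> close r B C -> close (e + r) A C.
Proof.
move=> [AB BA] [BC CB]; split.
  move=> a /AB[b /BC[c Cc bc] ab]; exists c => //.
  by apply: le_lt_trans (dist_triangle b _ _) _; rewrite ltrD.
move=> c /CB[b /BA[a Aa ba] cb]; exists a => //.
by apply: le_lt_trans (dist_triangle b _ _) _; rewrite addrC ltrD.
Qed.

Lemma close_image phi e A B : isometry phi ->
  close e A B -> close e (phi @` A) (phi @` B).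
Proof.
move=> iphi [AB BA]; split=> _ [x Xx <-].
  by have [b Bb xb] := AB x Xx; exists (phi b); [exists b|rewrite iphi].
by have [a Aa xa] := BA x Xx; exists (phi a); [exists a|rewrite iphi].
Qed.

Lemma hausdorff_close e A B : (hausdorff A B < e%:E)%E -> close e A B.
Proof.
rewrite gt_max => /andP[AB BA].
have pick X Y : (ereal_sup [set dist_set a Y | a in X] < e%:E)%E ->
    forall x, X x -> exists2 y, Y y & dist x y < e.
  move=> XY x Xx; have : (dist_set x Y < e%:E)%E.
    by apply: le_lt_trans XY; apply: ereal_sup_ubound; exists x.
  by move=> /ereal_inf_lt[_ [y Yy <-]]; rewrite lte_fin; exists y.
by split; exact: pick.
Qed.

Lemma close_hausdorff e A B : close e A B -> (hausdorff A B <= e%:E)%E.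
Proof.
have sup X Y : (forall x, X x -> exists2 y, Y y & dist x y < e) ->
    (ereal_sup [set dist_set a Y | a in X] <= e%:E)%E.
  move=> XY; apply: ge_ereal_sup => _ [x /XY[y Yy xy] <-].
  by apply: ge_ereal_inf; exists (dist x y)%:E; [exists y|rewrite lee_fin ltW].
by move=> [AB BA]; rewrite ge_max !sup.
Qed.

(** The limit is the set of points that lie, for each [k], within any [e > r k]
of [B k]. That each [b] of [B k] is close to it follows from a cluster point
of points [x j] of [B (k + j)] near [b]: for [i <= k + j] the point [x j] is
within [r i] of [B i], and this passes to the cluster point. *)
Lemma hausdorff_complete (B : nat -> set 'rV[R]_n) (r : nat -> R) :
  (forall k, compacts R n (B k)) ->
  (forall j k, (j <= k)%N -> close (r j) (B j) (B k)) ->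
  exists2 C, compacts R n C & forall k e, r k < e -> close e (B k) C.
Proof.
move=> cB BB.
pose C := [set x | forall k e, r k < e -> exists2 b, B k b & dist x b < e].
have BC k e b : r k < e -> B k b -> exists2 c, C c & dist b c < e.
  move=> rke Bb.
  have /choice[x xP] : forall j, exists y, B (k + j)%N y /\ dist b y < r k.
    move=> j; have [y By by_] := (BB k (k + j)%N (leq_addr _ _)).1 b Bb.
    by exists y.
  have bx j (i : unit) : dist 0 (x j) <= dist 0 b + r k.
    apply: le_trans (dist_triangle b _ _) _.
    by rewrite lerD2l ltW//; exact: (xP j).2.
  have [g gx] := pointwise_cluster bx.
  exists (g tt).
    move=> i e' rie'.
    have [|j ij xg] := gx [:: tt] (e' - r i) i; first by rewrite subr_gt0.
    have [y By yx] := (BB i (k + j)%N (leq_trans ij (leq_addl _ _))).2 _ (xP j).1.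
    exists y => //; apply: le_lt_trans (dist_triangle (x j) _ _) _.
    by have := xg tt (mem_head _ _); rewrite distC; lra.
  have [|j _ xg] := gx [:: tt] (e - r k) 0; first by rewrite subr_gt0.
  apply: le_lt_trans (dist_triangle (x j) _ _) _.
  by have := xg tt (mem_head _ _); have := (xP j).2; lra.
exists C; last first.
  by move=> k e rke; split=> [b|c Cc]; [exact: BC|exact: Cc].
have rlt k : r k < r k + 1 by rewrite ltrDl.
split; last first.
  have [b Bb] := (cB 0).2.
  by have [c Cc _] := BC 0 _ b (rlt 0) Bb; exists c.
apply/compact_distP; split.
  have [[M BM] _] := (compact_distP _).1 (cB 0).1.
  exists (M + (r 0 + 1)) => c Cc; have [b Bb cb] := Cc 0 _ (rlt 0).
  apply: le_trans (dist_triangle b _ _) _; rewrite (distC b) lerD ?BM//.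
  exact: ltW.
move=> x Cx k e rke.
have [|c Cc xc] := Cx ((e - r k) / 2); first by rewrite divr_gt0// subr_gt0.
have [|b Bb cb] := Cc k ((e + r k) / 2); first by lra.
by exists b => //; apply: le_lt_trans (dist_triangle c _ _) _; lra.
Qed.

End HausdorffDistance.

(** * Closeness up to isometry *)

Section Congruence.
Context {R : realType} {n : nat}.
Implicit Types (A B C : set 'rV[R]_n) (x y z : 'rV[R]_n) (e r : R).
Implicit Types phi psi : 'rV[R]_n -> 'rV[R]_n.

Definition congruent_within e A B : Prop :=
  exists2 phi, isometry phi & close e A (phi @` B).

Lemma isometry_comp phi psi : isometry phi -> isometry psi -> isometry (phi \o psi).
Proof. by move=> iphi ipsi x y /=; rewrite iphi ipsi. Qed.

Lemma compacts_isometry phi A : isometry phi -> compacts R n A ->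
  compacts R n (phi @` A).
Proof.
move=> iphi [cA [a0 Aa0]]; split; last by exists (phi a0); exists a0.
have [psi [ipsi phiK psiK]] := isometry_inv iphi.
have [[M AM] clA] := (compact_distP A).1 cA.
apply/compact_distP; split.
  exists (dist 0 (phi 0) + M) => _ [a Aa <-].
  by apply: le_trans (dist_triangle (phi 0) _ _) _; rewrite lerD2l iphi AM.
move=> x phiA; exists (psi x); last exact: psiK.
apply: clA => e /phiA[_ [a Aa <-] xa]; exists a => //.
by rewrite -iphi psiK.
Qed.

Lemma congruent_within_sym e A B : congruent_within e A B -> congruent_within e B A.
Proof.
move=> [phi /isometry_inv[psi [ipsi phiK _]] AB]; exists psi => //.
have := close_sym (close_image ipsi AB).
by rewrite image_comp (eq_imagel (f' := id)) ?image_id// => x _; exact: phiK.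
Qed.

Lemma congruent_within_trans B e r A C :
  congruent_within e A B -> congruent_within r B C -> congruent_within (e + r) A C.
Proof.
move=> [phi iphi AB] [psi ipsi BC]; exists (phi \o psi).
  exact: isometry_comp.
by rewrite -image_comp; apply: close_trans AB _; exact: close_image.
Qed.

(** The isometries [f k] realizing closeness [1 / (k + 1)] are bounded at every
point, since they send [b0] near [A]; let [phi] be a pointwise cluster point.
Then [phi b] is a cluster point of [f k b], which approaches [A], so [phi]
maps [B] into [A]. For surjectivity take [a] in [A] and [c] with [phi c = a]:
some [f k c] and some [f k b] with [b] in [B] are both near [a], so [c] is
near [b], and [c] is in [B] as [B] is closed. *)
Lemma congruent_within_all A B : compacts R n A -> compacts R n B ->
  (forall e, 0 < e -> congruent_within e A B) ->
  exists2 phi, isometry phi & A = phi @` B.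
Proof.
move=> [/compact_distP[[M AM] clA] _] [/compact_distP[_ clB] [b0 Bb0]] AB.
have /choice[f fP] : forall k : nat, exists f : 'rV[R]_n -> 'rV[R]_n,
    isometry f /\ close k.+1%:R^-1 A (f @` B).
  by move=> k; have [|f isof ABf] := AB k.+1%:R^-1; [rewrite invr_gt0|exists f].
have small e : 0 < e -> exists N, forall k, (N <= k)%N -> k.+1%:R^-1 < e.
  move=> e0; have [N _ NP] := near_infty_natSinv_lt (PosNum e0).
  by exists N => k; exact: NP.
have fbnd k x : dist 0 (f k x) <= M + 1 + dist b0 x.
  apply: le_trans (dist_triangle (f k b0) _ _) _; rewrite (fP k).1 lerD2r.
  have [|a Aa ab] := (fP k).2.2 (f k b0); first by exists b0.
  apply: le_trans (dist_triangle a _ _) _; rewrite lerD ?AM// distC.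
  by apply: le_trans (ltW ab) _; rewrite invf_le1// ler1n.
have [phi phiP] := pointwise_cluster fbnd.
have iphi : isometry phi.
  move=> x y; apply/eqP; rewrite eq_le; apply/andP; split;
    apply/ler_addgt0Pr => e e0.
    have [|k _ fk] := phiP [:: x; y] (e / 2) 0; first by rewrite divr_gt0.
    have := fk x (mem_head _ _); have : y \in [:: x; y] by rewrite !inE eqxx orbT.
    move=> /fk; rewrite -((fP k).1 x y).
    have := dist_triangle (f k x) (phi x) (phi y).
    have := dist_triangle (f k y) (f k x) (phi y).
    by rewrite (distC (phi x) (f k x)); lra.
  have [|k _ fk] := phiP [:: x; y] (e / 2) 0; first by rewrite divr_gt0.
  have := fk x (mem_head _ _); have : y \in [:: x; y] by rewrite !inE eqxx orbT.
  move=> /fk; rewrite -((fP k).1 x y).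
  have := dist_triangle (phi x) (f k x) (f k y).
  have := dist_triangle (phi y) (phi x) (f k y).
  by rewrite (distC (phi y) (f k y)); lra.
exists phi => //; apply/seteqP; split=> [a Aa|_ [b Bb <-]].
  have [psi [ipsi phiK psiK]] := isometry_inv iphi.
  exists (psi a); last exact: psiK.
  apply: clB => e e0.
  have [|N NP] := small (e / 2); first by rewrite divr_gt0.
  have [|k Nk fk] := phiP [:: psi a] (e / 2) N; first by rewrite divr_gt0.
  have [_ [b Bb <-] ab] := (fP k).2.1 a Aa.
  exists b => //; rewrite -((fP k).1); have := fk _ (mem_head _ _).
  have := dist_triangle a (f k (psi a)) (f k b); rewrite psiK.
  by have := lt_trans ab (NP k Nk); lra.
apply: clA => e e0.
have [|N NP] := small (e / 2); first by rewrite divr_gt0.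
have [|k Nk fk] := phiP [:: b] (e / 2) N; first by rewrite divr_gt0.
have [|a Aa ba] := (fP k).2.2 (f k b); first by exists b.
exists a => //; have := fk _ (mem_head _ _).
have := dist_triangle (f k b) (phi b) a; rewrite (distC (phi b) (f k b)).
by have := lt_trans ba (NP k Nk); lra.
Qed.

End Congruence.

(** * Radius and normalization *)

Section Normalization.
Context {R : realType} {n : nat}.
Implicit Types (A B C : set 'rV[R]_n) (x y z : 'rV[R]_n) (e r : R).

Lemma radius_ge0 A : A !=set0 -> (0 <= radius A)%E.
Proof.
move=> [a Aa]; apply: le_ereal_inf_tmp => _ [x _ <-].
apply: le_ereal_sup_tmp; exists (dist x a)%:E; first by exists a.
by rewrite lee_fin dist_ge0.
Qed.

Lemma radius_le A x r : (forall a, A a -> dist x a <= r) -> (radius A <= r%:E)%E.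
Proof.
move=> Ar; apply: ge_ereal_inf; eexists; first by exists x.
by apply: ge_ereal_sup => _ [a /Ar ar <-]; rewrite lee_fin.
Qed.

Lemma radius_lt A r : (radius A < r%:E)%E ->
  exists x, forall a, A a -> dist x a < r.
Proof.
move=> /ereal_inf_lt[_ [x _ <-] xr]; exists x => a Aa.
by rewrite -lte_fin; apply: le_lt_trans xr; apply: ereal_sup_ubound; exists a.
Qed.

Lemma radius_fin_num A : compacts R n A -> radius A \is a fin_num.
Proof.
move=> [/compact_distP[[M AM] _] A0]; rewrite ge0_fin_numE ?radius_ge0//.
exact: le_lt_trans (radius_le AM) (ltry _).
Qed.

(** A ball containing [A] contains [B] once its radius is increased by [e]. *)
Lemma close_radius e A B : compacts R n A -> compacts R n B ->
  close e A B -> fine (radius B) <= fine (radius A) + e.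
Proof.
move=> cA cB [_ BA]; apply/ler_addgt0Pr => t t0.
have [x xA] : exists x, forall a, A a -> dist x a < fine (radius A) + t.
  by apply: radius_lt; rewrite EFinD fineK ?radius_fin_num// lteDl// ?lte_fin ?radius_fin_num.
rewrite -lee_fin fineK ?radius_fin_num//; apply: (radius_le (x := x)) => b /BA[a Aa ba].
apply: le_trans (dist_triangle a _ _) _.
by have := xA a Aa; rewrite (distC a); lra.
Qed.

Lemma radius_set1 (a : 'rV[R]_n) : radius [set a] = 0%E.
Proof.
apply/eqP; rewrite eq_le radius_ge0; last by exists a.
by rewrite andbT; apply: (radius_le (x := a)) => _ ->; rewrite distxx.
Qed.

(** Two distinct points do not both lie at less than half their distance from a
common center. *)
Lemma radius_eq0 A : A !=set0 -> radius A = 0%E -> is_singleton A.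
Proof.
move=> [a Aa] rA; exists a; apply/seteqP; split=> [b Ab /=|_ ->//].
apply: contrapT => ba; have d0 : 0 < dist a b.
  rewrite lt0r dist_ge0 andbT; apply: contra_notN ba => /eqP/dist_eq0.
  by move=> ->.
have [|x xA] := @radius_lt A (dist a b / 2).
  by rewrite rA lte_fin divr_gt0.
have := xA a Aa; have := xA b Ab; have := dist_triangle x a b.
by rewrite (distC a x); lra.
Qed.

Lemma dist_scale r x y : 0 <= r -> dist (r *: x) (r *: y) = r * dist x y.
Proof.
move=> r0; rewrite -[r in RHS]ger0_norm// -sqrtr_sqr -sqrtrM ?sqr_ge0// mulr_sumr.
by congr Num.sqrt; apply: eq_bigr => i _; rewrite !mxE -mulrBr exprMn.
Qed.

Lemma fine_radius_gt0 A : compacts R n A -> ~ is_singleton A ->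
  0 < fine (radius A).
Proof.
move=> cA sA; rewrite lt0r fine_ge0 ?andbT; last exact: radius_ge0 cA.2.
apply: contra_notN sA => /eqP rA; apply: radius_eq0 (proj2 cA) _.
by rewrite -(fineK (radius_fin_num cA)) rA.
Qed.

Lemma similar_normalize A : compacts R n A -> similar A (normalize A).
Proof.
rewrite /normalize; case: asboolP => sA cA; first exact: similar_refl.
have rA := fine_radius_gt0 cA sA.
exists (fun x => (fine (radius A))^-1 *: x) => //.
exists (fine (radius A))^-1; first by rewrite invr_gt0.
by move=> x y; rewrite dist_scale// invr_ge0 ltW.
Qed.

Lemma compacts_normalize A : compacts R n A -> compacts R n (normalize A).
Proof.
rewrite /normalize; case: asboolP => // _ [cA [a Aa]]; split.
  apply: continuous_compact cA; apply: continuous_subspaceT.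
  exact: scaler_continuous.
by eexists; exists a.
Qed.

Lemma radius_normalize A : compacts R n A ->
  fine (radius (normalize A)) = 0 \/ fine (radius (normalize A)) = 1.
Proof.
rewrite /normalize; case: asboolP => [[a ->] _|sA cA].
  by left; rewrite radius_set1.
have rA := fine_radius_gt0 cA sA; right.
rewrite (@radius_similitude _ _ _ (fine (radius A))^-1) ?invr_gt0//; last first.
  by move=> x y; rewrite dist_scale// invr_ge0 ltW.
by rewrite fineM ?radius_fin_num//= mulVf// gt_eqF.
Qed.

Lemma normalize_id A : compacts R n A ->
  fine (radius A) = 0 \/ fine (radius A) = 1 -> normalize A = A.
Proof.
rewrite /normalize; case: asboolP => // sA cA [r0|->].
  by have := fine_radius_gt0 cA sA; rewrite r0 ltxx.
by rewrite invr1 /scale; under eq_imagel do rewrite scale1r; rewrite image_id.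
Qed.

(** The radius of [C] is a limit of elements of the closed set [{0, 1}]. *)
Lemma radius_limit_normalized C : compacts R n C ->
  (forall e, 0 < e -> exists A, [/\ compacts R n A, close e A C &
     fine (radius A) = 0 \/ fine (radius A) = 1]) ->
  fine (radius C) = 0 \/ fine (radius C) = 1.
Proof.
move=> cC AC; have rC : 0 <= fine (radius C) by rewrite fine_ge0// radius_ge0//; exact: cC.2.
have [->|r0] := eqVneq (fine (radius C)) 0; first by left.
have [->|r1] := eqVneq (fine (radius C)) 1; first by right.
(* Half the distance from the radius of [C] to [{0, 1}]. *)
have [|A [cA AC' rA]] :=
    AC (Num.min (fine (radius C)) `|fine (radius C) - 1| / 2).
  by rewrite divr_gt0// lt_min normr_gt0 subr_eq0 r1 lt0r r0 rC.
have := close_radius cA cC AC'; have := close_radius cC cA (close_sym AC').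
have : 0 < `|fine (radius C) - 1| by rewrite normr_gt0 subr_eq0.
have : 0 < fine (radius C) by rewrite lt0r r0.
set t := fine (radius C); set s := fine _ in rA *.
rewrite minEle; case: ifP; case: (ger0P (t - 1)) => _; case: rA => ->; lra.
Qed.

End Normalization.
(** * The metric on similarity classes *)

Section ShapeDifference.
Context {R : realType} {n : nat}.
Implicit Types (A B C : set 'rV[R]_n) (e : R) (K L : shapes R n).

Lemma compacts_bounded A : compacts R n A -> bounded_set A.
Proof. by move=> [/compact_bounded]. Qed.

(** The infimum defining [shape_diff] moves both sets; undoing the isometry
applied to the first one leaves a single isometry. *)
Lemma shape_diff_ltP A B e : compacts R n A -> compacts R n B ->
  shape_diff A B < e -> congruent_within e (normalize A) (normalize B).
Proof.
move=> cA cB; rewrite -lte_fin fineK; last first.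
  by apply: hausdorff_isom_normalize_fin_num;
    [exact: cA.2|exact: cB.2|exact: compacts_bounded..].
move=> /ereal_inf_lt[_ [phi [psi [iphi ipsi ->]]] /hausdorff_close AB].
have [phi' [iphi' phiK _]] := isometry_inv iphi.
exists (phi' \o psi); first exact: isometry_comp.
have := close_image iphi' AB.
by rewrite !image_comp (eq_imagel (f' := id)) ?image_id// => x _; exact: phiK.
Qed.

Lemma shape_diff_le A B e : compacts R n A -> compacts R n B ->
  congruent_within e (normalize A) (normalize B) -> shape_diff A B <= e.
Proof.
move=> cA cB [phi iphi AB]; rewrite -lee_fin fineK; last first.
  by apply: hausdorff_isom_normalize_fin_num;
    [exact: cA.2|exact: cB.2|exact: compacts_bounded..].
apply: ge_ereal_inf; exists (hausdorff (normalize A) (phi @` normalize B)).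
  by exists id, phi; split => //; rewrite image_id.
exact: close_hausdorff.
Qed.

Lemma shape_diff_ge0 A B : compacts R n A -> compacts R n B ->
  0 <= shape_diff A B.
Proof.
move=> cA cB; rewrite leNgt; apply/negP => /(shape_diff_ltP cA cB)[phi _ [AB _]].
have [a Aa] := (compacts_normalize cA).2.
by have [b _] := AB a Aa; rewrite ltNge dist_ge0.
Qed.

Lemma shape_reprP K : compacts R n (shape_repr K) /\ val K = sim_class (shape_repr K).
Proof. by rewrite /shape_repr; case: cid2. Qed.

Lemma shape_classP A : compacts R n A -> exists K, val K = sim_class A.
Proof.
move=> cA; have sA : sim_class A \in shapes R n by apply/mem_set; exists A.
by exists (SigSub sA).
Qed.

Lemma class_diff_metric : is_metric (@class_diff R n).
Proof.
have cr K := (shape_reprP K).1.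
have cn K := compacts_normalize (cr K).
have sim K L : (forall e, 0 < e -> class_diff K L < e) -> K = L.
  move=> KL; have [e e0|phi iphi KE] := congruent_within_all (cn K) (cn L).
    exact: shape_diff_ltP (cr K) (cr L) (KL e e0).
  apply: val_inj; rewrite (shape_reprP K).2 (shape_reprP L).2.
  apply/sim_class_eqP; apply: similar_trans (similar_normalize (cr K)) _.
  apply: similar_sym; apply: similar_trans (similar_normalize (cr L)) _.
  by rewrite KE; exists phi => //; exists 1 => // x y; rewrite mul1r iphi.
have symle K L : class_diff K L <= class_diff L K.
  apply/ler_addgt0Pr => e e0; apply: shape_diff_le (cr K) (cr L) _.
  by apply/congruent_within_sym/(shape_diff_ltP (cr L) (cr K)); rewrite ltrDl.
split.
- by move=> K L; exact: shape_diff_ge0.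
- move=> K L; split=> [KL|->]; first by apply: sim => e; rewrite KL.
  apply/eqP; rewrite eq_le shape_diff_ge0// andbT; apply/ler_addgt0Pl => e e0.
  rewrite addr0; apply: shape_diff_le => //; exists id => //.
  by rewrite image_id; exact: close_refl.
- by move=> K L; apply: le_anti; apply/andP; split; exact: symle.
move=> K L M; apply/ler_addgt0Pr => e e0.
apply: shape_diff_le (cr K) (cr M) _.
rewrite [X in _ + X](splitr e) addrACA.
by apply: (congruent_within_trans (B := normalize (shape_repr L)));
  apply: shape_diff_ltP => //; rewrite ltrDl divr_gt0.
Qed.

(** Each congruence only relates neighbours [A k] and [A k.+1]; composing the
first [k] isometries moves all the sets into one frame and preserves the
successive distances. *)
Lemma align_chain (A : nat -> set 'rV[R]_n) (r : nat -> R) :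
  (forall k, congruent_within (r k) (A k) (A k.+1)) ->
  exists2 psi : nat -> 'rV[R]_n -> 'rV[R]_n, forall k, isometry (psi k) &
    forall k, close (r k) (psi k @` A k) (psi k.+1 @` A k.+1).
Proof.
move=> AA; have /choice[phi phiP] : forall k, exists phi,
    isometry phi /\ close (r k) (A k) (phi @` A k.+1).
  by move=> k; have [phi iphi AAk] := AA k; exists phi.
pose psi := fix psi k := if k is k'.+1 then psi k' \o phi k' else id.
have ipsi k : isometry (psi k).
  by elim: k => // k IHk; apply: isometry_comp => //; exact: (phiP k).1.
exists psi => // k; rewrite -[psi k.+1]/(psi k \o phi k) -image_comp.
by apply: close_image => //; exact: (phiP k).2.
Qed.

(** The geometric tail starting at [j] sums to [2 * 2^-j]; this bound is strict
for finite sums, which [close] requires. *)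
Lemma close_geometric (B : nat -> set 'rV[R]_n) :
  (forall k, close (2^-1 ^+ k) (B k) (B k.+1)) ->
  forall j k, (j <= k)%N -> close (2 * 2^-1 ^+ j) (B j) (B k).
Proof.
move=> BB j k /subnK <-; move: (k - j)%N => m; elim: m j {k} => [|m IHm] j.
  by apply: close_refl; rewrite mulr_gt0// exprn_gt0.
rewrite addSnnS (_ : 2 * _ = 2^-1 ^+ j + 2 * 2^-1 ^+ j.+1).
  exact: close_trans (BB j) (IHm j.+1).
by rewrite exprS; field.
Qed.

Lemma small_pow2 e : 0 < e -> exists k, 2^-1 ^+ k < e.
Proof.
move=> e0; have [N _ NP] := near_infty_natSinv_expn_lt (PosNum e0).
by exists N; have := NP N (leqnn N); rewrite /= div1r exprVn.
Qed.

Lemma cauchy_fast (T : Type) (d : T -> T -> R) (u : nat -> T) :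
  is_cauchy d u -> exists s : nat -> nat, (forall k, (s k <= s k.+1)%N) /\
    forall k i j, (s k <= i)%N -> (s k <= j)%N -> d (u i) (u j) < 2^-1 ^+ k.
Proof.
move=> cu; have /choice[N NP] : forall k, exists N : nat, forall i j,
    (N <= i)%N -> (N <= j)%N -> d (u i) (u j) < 2^-1 ^+ k.
  by move=> k; apply: cu; rewrite exprn_gt0.
exists (fun k => \max_(i < k.+1) N i); split=> [k|k i j ki kj].
  by rewrite [leqRHS]big_ord_recr leq_maxl.
have Nk : (N k <= \max_(i < k.+1) N i)%N by rewrite big_ord_recr leq_maxr.
by apply: NP; [exact: leq_trans Nk ki|exact: leq_trans Nk kj].
Qed.

(** The limit of the aligned fast subsequence attracts the whole sequence: from
the index [s k] on, the terms are within [2^-k] of the [k]-th term of the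
subsequence. *)
Lemma class_diff_complete : is_complete (@class_diff R n).
Proof.
move=> u /cauchy_fast[s [sS us]].
have cr i := (shape_reprP (u i)).1.
pose A i := normalize (shape_repr (u i)).
have cA i : compacts R n (A i) := compacts_normalize (cr i).
have AA i j k : (s k <= i)%N -> (s k <= j)%N ->
    congruent_within (2^-1 ^+ k) (A i) (A j).
  by move=> ki kj; exact: shape_diff_ltP (cr i) (cr j) (us k i j ki kj).
have [psi ipsi psiB] : exists2 psi : nat -> 'rV[R]_n -> 'rV[R]_n,
    forall k, isometry (psi k) &
    forall k, close (2^-1 ^+ k) (psi k @` A (s k)) (psi k.+1 @` A (s k.+1)).
  by apply: (align_chain (A := A \o s)) => k; exact: AA.
have cB k : compacts R n (psi k @` A (s k)).
  exact: compacts_isometry.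
have [C cC BC] := hausdorff_complete cB (close_geometric psiB).
have rC : fine (radius C) = 0 \/ fine (radius C) = 1.
  apply: radius_limit_normalized => // e e0.
  have [|k ke] := @small_pow2 (e / 2); first by rewrite divr_gt0.
  exists (psi k @` A (s k)); split => //; first by apply: BC; lra.
  rewrite (@radius_similitude _ _ _ 1)// => [|x y]; last by rewrite mul1r ipsi.
  by rewrite mul1e; exact: radius_normalize.
have [L LC] := shape_classP cC.
(* The class of the i-th term is within [2^-k] of the k-th aligned set, which
   is within any bound larger than [2 * 2^-k], here [3 * 2^-k], of [C]. *)
exists L => e e0; have [|k ke] := @small_pow2 (e / 5); first by rewrite divr_gt0.
exists (s k) => i ki; rewrite (class_diffE (cr i) cC (shape_reprP (u i)).2 LC).
apply: (@le_lt_trans _ _ (2^-1 ^+ k + 3 * 2^-1 ^+ k)); last by lra.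
apply: shape_diff_le => //; rewrite (normalize_id cC rC).
apply: congruent_within_trans (AA i (s k) k ki (leqnn _)) _.
apply: congruent_within_sym; exists (psi k) => //; apply: close_sym.
by apply: BC; rewrite ltr_pM2r ?exprn_gt0// ltr_nat.
Qed.

End ShapeDifference.

Theorem theorem2p7 (R : realType) (n : nat) :
  is_metric (@class_diff R n) /\ is_complete (@class_diff R n).
Proof. by split; [exact: class_diff_metric|exact: class_diff_complete]. Qed.
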